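(* Consider an execution of PI-ADMM1 with $N$ agents and fix an agent $i\in\mathcal{V}=\{1,\dots,N\}$. The states, multipliers and gradients of agent $i$, i.e. $x_i^k$, $y_i^k$ and $\nabla f_i(x_i^k)$, $k=0,1,\dots$, cannot be inferred by the other $N-1$ agents, even if these collude.
   Context: PI-ADMM1: $\mathcal{V}=\{1,\dots,N\}$ is the set of agents, $f_i:\mathbb{R}^p\to\mathbb{R}$ is the private differentiable function of agent $i$ (with Lipschitz gradient), $\rho>0$ is a parameter, and $i_k=(k\bmod N)+1$ is the agent activated at iteration $k$. Initialization: $z^0=\boldsymbol{0}$, and each agent $i$ privately generates a random $x_i^0\in\mathbb{R}^p$ and sets $y_i^0=\rho x_i^0$. At iteration $k=0,1,2,\dots$ agent $i_k$ privately generates a scalar $\gamma_{i_k}^k>0$, sets $\tilde\rho_{i_k}^k=\rho\gamma_{i_k}^k$, and - (primal) $x_{i_k}^{k+1}=\arg\min_{x}\ f_{i_k}(x)+\frac{\tilde\rho_{i_k}^k}{2}\left\|z^k-x+\frac{y_{i_k}^k}{\tilde\rho_{i_k}^k}\right\|^2$, and $x_i^{k+1}=x_i^k$ for $i\neq i_k$; - (dual) $y_{i_k}^{k+1}=y_{i_k}^k+\rho\gamma_{i_k}^k(z^k-x_{i_k}^{k+1})$, and $y_i^{k+1}=y_i^k$ for $i\ne i_k$; - (token) $z^{k+1}=z^k+\frac1N\left[\left(x_{i_k}^{k+1}-\frac{y_{i_k}^{k+1}}{\rho}\right)-\left(x_{i_k}^{k}-\frac{y_{i_k}^{k}}{\rho}\right)\right]$,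 after which $z^{k+1}$ is transmitted to agent $i_{k+1}$. The optimality condition of the primal update together with the dual update gives $\nabla f_{i_k}(x_{i_k}^{k+1})=y_{i_k}^{k+1}$. Privacy notion: a mechanism is privacy preserving if its input cannot be uniquely derived from its output. Colluding-agents model: the $N-1$ agents in $\mathcal{V}\setminus\{i\}$ pool their information. They know $N$, $\rho$, the activation order, the form of the algorithm, all tokens $z^k$, $k\ge 0$, and all of their own quantities $x_j^k$, $y_j^k$, $\nabla f_j(x_j^k)$ and $\gamma_{j}^k$ for $j\in\mathcal{V}\setminus\{i\}$. The quantities $x_i^k$, $y_i^k$, $\nabla f_i(x_i^k)$ and the scalars $\gamma_i^k>0$ (for those $k$ with $i_k=i$) of agent $i$ are unknown to them. The relations available among these unknowns are: $x_i^0-y_i^0/\rho=\boldsymbol{0}$; the dual update and token update for every $k$ with $i_k=i$; the fact that $x_i,y_i$ do not change at iterations with $i_k\neq i$; and $\nabla f_i(x_i^{k+1})=y_i^{k+1}$ for every $k$ with $i_k=i$ (the gradient values being treated as unknown vectors). A quantity ''can be inferred'' if it takes the same value in all solutions of this system of relations consistent with the known quantities; otherwise it ''cannot be inferred''. *)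

(* Defs.v *)
From HB Require Import structures.
From mathcomp Require Import all_boot all_order all_algebra.
From mathcomp Require Import all_classical all_reals all_analysis.

Set Implicit Arguments.
Unset Strict Implicit.
Unset Printing Implicit Defensive.

Import Order.TTheory GRing.Theory Num.Theory.
Import numFieldNormedType.Exports.

Local Open Scope ring_scope.

(* The library norm on 'rV[R]_p is the sup norm, whereas the primal update
   penalizes the squared Euclidean norm. *)
Definition sqnorm2 (R : realType) (p : nat) (v : 'rV[R]_p) : R :=
  \sum_(j < p) v ord0 j ^+ 2.

(* Vector of partial derivatives; the gradient when f is differentiable. *)
Definition gradient (R : realType) (p : nat) (f : 'rV[R]_p -> R)
    (x : 'rV[R]_p) : 'rV[R]_p :=
  \row_(j < p) 'D_(delta_mx ord0 j) f x.

(* The Lipschitz property refers to the sup norm; as the constant L is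
   existentially quantified, this does not depend on the choice of norm. *)
Definition smooth (R : realType) (p : nat) (f : 'rV[R]_p -> R) : Prop :=
  (forall x, differentiable f x) /\ exists L : R, L.-lipschitz (gradient f).

Definition is_argmin (R : realType) (T : Type) (F : T -> R) (x : T) : Prop :=
  forall u, F x <= F u.

(* Agents are numbered from 0, so agent (k mod N) + 1 of {1, ..., N} is the
   element k %% N of 'I_N. *)
Definition active (N k : nat) (j : 'I_N) : bool := nat_of_ord j == (k %% N)%N.

(* All quantities of a run: x_j^k, y_j^k, the value of the gradient of f_j at
   x_j^k, gamma_j^k and z^k. Only the scalars [gamma j k] with [active k j] are
   meaningful; no update involves the other ones. *)
Record trace (R : realType) (N p : nat) := Trace {
  state : 'I_N -> nat -> 'rV[R]_p;
  mult : 'I_N -> nat -> 'rV[R]_p;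
  grad : 'I_N -> nat -> 'rV[R]_p;
  gamma : 'I_N -> nat -> R;
  token : nat -> 'rV[R]_p
}.

Section Updates.
Variables (R : realType) (N p : nat) (rho : R) (t : trace R N p).

Definition primal_update (f : 'rV[R]_p -> R) (j : 'I_N) (k : nat) : Prop :=
  let rhot := rho * gamma t j k in
  is_argmin
    (fun x => f x +
       rhot / 2 * sqnorm2 (token t k - x + rhot^-1 *: mult t j k))
    (state t j k.+1).

Definition dual_update (j : 'I_N) (k : nat) : Prop :=
  mult t j k.+1 =
  mult t j k + (rho * gamma t j k) *: (token t k - state t j k.+1).

Definition token_update (j : 'I_N) (k : nat) : Prop :=
  token t k.+1 = token t k + N%:R^-1 *:
    ((state t j k.+1 - rho^-1 *: mult t j k.+1) -
     (state t j k - rho^-1 *: mult t j k)).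

End Updates.

(* The random initial states and the privately generated scalars are arbitrary:
   a trace is an execution for some outcome of the random choices. *)
Record PI_ADMM1 (R : realType) (N p : nat) (f : 'I_N -> 'rV[R]_p -> R)
    (rho : R) (t : trace R N p) : Prop := {
  exec_token0 : token t 0 = 0;
  exec_mult0 : forall j, mult t j 0 = rho *: state t j 0;
  exec_gamma : forall j k, active k j -> 0 < gamma t j k;
  exec_primal : forall j k, active k j -> primal_update rho t (f j) j k;
  exec_dual : forall j k, active k j -> dual_update rho t j k;
  exec_token : forall j k, active k j -> token_update rho t j k;
  exec_idle_state : forall j k, ~~ active k j -> state t j k.+1 = state t j k;
  exec_idle_mult : forall j k, ~~ active k j -> mult t j k.+1 = mult t j k;
  exec_grad : forall j k, grad t j k = gradient (f j) (state t j k)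
}.

Definition same_view (R : realType) (N p : nat) (i : 'I_N)
    (t t' : trace R N p) : Prop :=
  (forall k, token t' k = token t k) /\
  (forall j k, j != i ->
     [/\ state t' j k = state t j k, mult t' j k = mult t j k,
         grad t' j k = grad t j k & gamma t' j k = gamma t j k]).

(* The gradient values are unknown vectors, not tied to any function;
   [rel_idle_grad] records that while x_i stays put, the gradient at x_i
   remains the same unknown vector. *)
Record agent_relations (R : realType) (N p : nat) (rho : R) (i : 'I_N)
    (t : trace R N p) : Prop := {
  rel_init : state t i 0 - rho^-1 *: mult t i 0 = 0;
  rel_gamma : forall k, active k i -> 0 < gamma t i k;
  rel_dual : forall k, active k i -> dual_update rho t i k;
  rel_token : forall k, active k i -> token_update rho t i k;
  rel_grad : forall k, active k i -> grad t i k.+1 = mult t i k.+1;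
  rel_idle_state : forall k, ~~ active k i -> state t i k.+1 = state t i k;
  rel_idle_mult : forall k, ~~ active k i -> mult t i k.+1 = mult t i k;
  rel_idle_grad : forall k, ~~ active k i -> grad t i k.+1 = grad t i k
}.

Definition consistent_solution (R : realType) (N p : nat) (rho : R) (i : 'I_N)
    (t t' : trace R N p) : Prop :=
  same_view i t t' /\ agent_relations rho i t'.

Definition can_be_inferred (R : realType) (N p : nat) (rho : R) (i : 'I_N)
    (t : trace R N p) (T : Type) (q : trace R N p -> T) : Prop :=
  forall t1 t2, consistent_solution rho i t t1 ->
    consistent_solution rho i t t2 -> q t1 = q t2.

(* Main.v *)
(** The colluding agents know the tokens, hence only x_i^k - y_i^k / rho, the
    accumulated scaled token increments of agent i.  A perturbation of y_i by
    v_k and of x_i by v_k / rho leaves this difference unchanged, and it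
    respects the dual update with the same gamma exactly when
    v_(k+1) = v_k / (1 + gamma_i^k) at the active iterations and
    v_(k+1) = v_k at the idle ones.  As v_0 is free and never contracts to 0 in
    finitely many steps, no x_i^k or y_i^k is determined.  The gradient values
    may be taken equal to the multipliers at every iteration, so they are not
    determined either. *)
Require Import Defs.
From mathcomp Require Import all_boot all_order all_algebra.
From mathcomp Require Import all_classical all_reals all_analysis.
From mathcomp Require Import ring.

Import Order.TTheory GRing.Theory Num.Theory.

Local Open Scope ring_scope.

Fixpoint damping (R : realType) (N p : nat) (t : trace R N p) (i : 'I_N)
    (k : nat) : R :=
  if k is m.+1 then
    if active m i then damping R N p t i m / (1 + gamma t i m)
    else damping R N p t i m
  else 1.
Arguments damping {R N p} t i k.

Definition perturb (R : realType) (N p : nat) (rho : R) (t : trace R N p)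
    (i : 'I_N) (d : 'rV[R]_p) : trace R N p :=
  let mult' k := mult t i k + damping t i k *: d in
  {| state := fun j k => if j == i then
       state t i k + (rho^-1 * damping t i k) *: d else state t j k;
     mult := fun j k => if j == i then mult' k else mult t j k;
     grad := fun j k => if j == i then mult' k else grad t j k;
     gamma := gamma t;
     token := token t |}.
Arguments perturb {R N p} rho t i d.

Lemma damping_gt0 (R : realType) (N p : nat) (t : trace R N p) (i : 'I_N)
    (gamma_gt0 : forall k, active k i -> 0 < gamma t i k) (k : nat) :
  0 < damping t i k.
Proof.
elim: k => [|k IHk] /=; first exact: ltr01.
case: ifP => // act; apply: divr_gt0 => //.
by apply: addr_gt0; [exact: ltr01 | exact: gamma_gt0].
Qed.

Lemma perturb_consistent (R : realType) (N p : nat)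
    (f : 'I_N -> 'rV[R]_p -> R) (rho : R) (rho_gt0 : 0 < rho)
    (t : trace R N p) (t_exec : PI_ADMM1 f rho t) (i : 'I_N) (d : 'rV[R]_p) :
  consistent_solution rho i t (perturb rho t i d).
Proof.
have rho_neq0 : rho != 0 by rewrite gt_eqF.
split; first by split=> // j k /negPf ji; rewrite /= ji.
split=> [|k|k act|k act|k act|k idle|k idle|k idle];
  rewrite /dual_update /token_update /= ?eqxx //.
- by rewrite (exec_mult0 t_exec); apply/rowP => j; rewrite !mxE; field.
- exact: (exec_gamma t_exec).
- have g_gt0 := exec_gamma t_exec act.
  have g1_neq0 : 1 + gamma t i k != 0 by rewrite gt_eqF // addr_gt0 // ltr01.
  (* With [a = damping t i k] and [g = gamma t i k], the coefficients of [d] agree since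
     [a / (1 + g) = a - g * (a / (1 + g))]. *)
  rewrite act {1}(exec_dual t_exec act).
  by apply/rowP => j; rewrite !mxE; field; rewrite g1_neq0.
- rewrite {1}(exec_token t_exec act).
  by apply/rowP => j; rewrite !mxE; ring.
- by rewrite (negPf idle) (exec_idle_state t_exec).
- by rewrite (negPf idle) (exec_idle_mult t_exec).
- by rewrite (negPf idle) (exec_idle_mult t_exec).
Qed.

Theorem theorem3 (R : realType) (N p : nat) (p_gt0 : (0 < p)%N)
    (f : 'I_N -> 'rV[R]_p -> R) (f_smooth : forall j, smooth (f j))
    (rho : R) (rho_gt0 : 0 < rho)
    (t : trace R N p) (t_exec : PI_ADMM1 f rho t) (i : 'I_N) (k : nat) :
  [/\ ~ can_be_inferred rho i t (fun s => state s i k),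
      ~ can_be_inferred rho i t (fun s => mult s i k) &
      ~ can_be_inferred rho i t (fun s => grad s i k)].
Proof.
have a_neq0 : damping t i k != 0.
  by rewrite gt_eqF // damping_gt0 // => m; exact: (exec_gamma t_exec).
have shift_neq (c : R) (u : 'rV[R]_p) : c != 0 ->
    u + c *: 0 <> u + c *: const_mx 1.
  (* A coordinate to compare exists only because [0 < p]. *)
  move=> c_neq0 /addrI /rowP /(_ (Ordinal p_gt0)).
  by rewrite !mxE mulr0 mulr1 => /esym/eqP; rewrite (negPf c_neq0).
have sol d := perturb_consistent R N p f rho rho_gt0 t t_exec i d.
(* The case [d = 0] replaces [t] itself: before the first activation of [i], the gradient in [t]
   need not be the multiplier. *)
split=> /(_ _ _ (sol 0) (sol (const_mx 1))) /=; rewrite eqxx;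
  apply: shift_neq => //.
by rewrite mulf_neq0 // invr_eq0 gt_eqF.
Qed.
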